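(* Let $D$ be a planar knotoid diagram and let $-D$ be the inverse of $D$. Then (1) $B_{-D}(x,v)=-B_D(x^{-1},v)$ and $C_{-D}(x,v)=-C_D(x,v^{-1})$; (2) $\widetilde{B}_{-D}(x,v)=-\widetilde{B}_D(x^{-1},v^{-1})$ and $\widetilde{C}_{-D}(x,v)=-\widetilde{C}_D(x,v)$.
   Context: **Knotoid diagrams.** A planar knotoid diagram $D$ is a generic immersion $f:[0,1]\to\mathbb{R}^2$ (its only multiple points are finitely many transverse double points, called crossings, distinct from $f(0)$ and $f(1)$) with over/under information at each crossing; it is oriented from its leg $f(0)$ to its head $f(1)$. $C(D)$ is the set of crossings. The sign $\mathrm{sgn}(c)$ is $+1$ if (tangent of overstrand, tangent of understrand) is a positively oriented basis of $\mathbb{R}^2$, and $-1$ otherwise. The inverse $-D$ is the same diagram with reversed orientation (leg and head exchanged), with the same over/under information. **Coloring number.** The arcs of $D$ are the closures of the components of $D\setminus C(D)$. A Cheng coloring assigns an integer to each arc so that, travelling along $D$, at each passage through a crossing (over or under) the label increases by $1$ if the curve crosses the other strand from right to left (with respect to that other strand's orientation) and decreases by $1$ if from left to right. It is unique up to an additive constant. At a crossing $c$, let $a$ be the label of the incoming arc of the strand crossing the other one from right to left (its outgoing arc has label $a+1$), and $b$ the label of the outgoing arc of the other strand (its incoming arc has label $b+1$). Then $u(c)=a-b$. **Gauss diagram.** $G(D)$ is the interval $[0,1]$ drawn as a counterclockwise oriented arc of a circle (with a gap between head and leg), with one chord for each crossing $c$ (also denoted $c$) joining its two preimages and oriented from the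 over-preimage to the under-preimage; the starting point of the chord carries the sign $\mathrm{sgn}(c)$ and the ending point carries $-\mathrm{sgn}(c)$. For a chord $c$, $r(c)$ (resp. $l(c)$) is the set of chords $e$ crossing $c$ and pointing to the right (resp. left) hand side of $c$. The lead side of $c$ is the side containing the leg and the head; $\lambda(c)$ is the set of chords crossing $c$ and pointing to the lead side of $c$, and $\rho(c)$ the set of chords crossing $c$ and pointing from the lead side to the other side. The degree is $d(c)=\sum_{e\in r(c)}\mathrm{sgn}(e)-\sum_{e\in l(c)}\mathrm{sgn}(e)$, and the intersection index $i(c)$ is the sum of the signs of the chord endpoints on the lead side of $c$, the endpoints of $c$ excluded. **Index functions.** Let $R_m=\mathbb{Z}[v,v^{-1}]/(v^m-1)$ for $m\ge 0$ (so $R_0=\mathbb{Z}[v,v^{-1}]$). For a chord $c$, $\phi_c:\mathbb{Z}\to\{0,1,\dots,|d(c)|-1\}$ is reduction modulo $|d(c)|$ (the identity of $\mathbb{Z}$ if $d(c)=0$). In $R_{|d(c)|}$ define $g_c(v)=\sum_{e\in r(c)}\mathrm{sgn}(e)v^{\phi_c(d(e))}-\sum_{e\in l(c)}\mathrm{sgn}(e)v^{\phi_c(-d(e))}$, $h_c(v)=\sum_{e\in\rho(c)}\mathrm{sgn}(e)v^{\phi_c(d(e))}-\sum_{e\in\lambda(c)}\mathrm{sgn}(e)v^{\phi_c(-d(e))}$, $\widetilde g_c(v)=\sum_{e\in r(c)}\mathrm{sgn}(e)v^{\phi_c(i(e))}-\sum_{e\in l(c)}\mathrm{sgn}(e)v^{\phi_c(-i(e))}$,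 $\widetilde h_c(v)=\sum_{e\in\rho(c)}\mathrm{sgn}(e)v^{\phi_c(i(e))}-\sum_{e\in\lambda(c)}\mathrm{sgn}(e)v^{\phi_c(-i(e))}$. **4-phases functions.** $B_D(x,v)=\sum_{c\in C(D)}u(c)x^{g_c(v)}$, $C_D(x,v)=\sum_{c\in C(D)}u(c)x^{h_c(v)}$, $\widetilde B_D(x,v)=\sum_{c\in C(D)}u(c)x^{\widetilde g_c(v)}$, $\widetilde C_D(x,v)=\sum_{c\in C(D)}u(c)x^{\widetilde h_c(v)}$, regarded as elements of the free abelian group on formal symbols $x^p$ with $p\in\bigsqcup_{m\ge0}R_m$. Replacing $x$ by $x^{-1}$ sends $x^p$ to $x^{-p}$; replacing $v$ by $v^{-1}$ sends $x^{p(v)}$ to $x^{p(v^{-1})}$ (with $p(v^{-1})$ taken in the same $R_m$). *)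

(* Defs.v *)
From HB Require Import structures.
From mathcomp Require Import all_boot all_order all_algebra.
From mathcomp Require Import ring_quotient generic_quotient.
From mathcomp Require Import all_classical all_reals all_analysis.
From mathcomp Require Import finmap zify.
From mathcomp.multinomials Require Import freeg.
Import Order.TTheory GRing.Theory Num.Theory numFieldNormedType.Exports.

Set Implicit Arguments.
Unset Strict Implicit.
Unset Printing Implicit Defensive.

Local Open Scope classical_set_scope.
Local Open Scope ring_scope.
Local Open Scope quotient_scope.

HB.instance Definition _ (K : choiceType) (M : lmodType int) (f : K -> M) :=
  GRing.isZmodMorphism.Build {freeg K} M (fglift f) (lift_is_additive f).

Lemma fgliftE (K : choiceType) (M : lmodType int) (f : K -> M) (p : {freeg K}) :
  fglift f p = \sum_(k <- dom p) coeff k p *: f k.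
Proof.
rewrite -{1}(freeg_sumE p) raddf_sum; apply: eq_bigr => k _.
by rewrite [LHS]liftU.
Qed.

Lemma fgliftU1 (K : choiceType) (M : lmodType int) (f : K -> M) k :
  fglift f << k >> = f k.
Proof. by rewrite liftU scale1r. Qed.

Lemma fglift_exchange (K : choiceType) (M : lmodType int) (f : K -> K -> M)
    (p q : {freeg K}) :
  fglift (fun a => fglift (f a) q) p = fglift (fun b => fglift (f^~ b) p) q.
Proof.
rewrite fgliftE.
under eq_bigr do rewrite fgliftE scaler_sumr.
rewrite exchange_big fgliftE; apply: eq_bigr => b _.
rewrite fgliftE scaler_sumr; apply: eq_bigr => a _.
by rewrite !scalerA mulrC.
Qed.

Lemma additive_freeg_eq (K : choiceType) (V : zmodType)
    (F G : {additive {freeg K} -> V}) :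
  (forall k, F << k >> = G << k >>) -> F =1 G.
Proof.
move=> FG p; rewrite -(freeg_sumE p) !raddf_sum; apply: eq_bigr => k _.
by rewrite -[coeff k p]intz -freegU_mulz !raddfMz FG.
Qed.

Lemma fset_set_ltn_card (T : choiceType) (A B : set T) (x : T) :
  finite_set B -> A `<=` B -> B x -> ~ A x ->
  (#|` fset_set A| < #|` fset_set B|)%N.
Proof.
move=> finB AB Bx nAx; have finA := sub_finite_set AB finB.
apply: fproper_ltn_card; rewrite fproperE; apply/andP; split.
  by rewrite -fset_set_sub.
by apply/negP; rewrite -fset_set_sub // => /(_ x Bx).
Qed.

(* Z[v, v^-1] is the free abelian group on the symbols v^k (k in Z), the product
   being the bilinear extension of v^a v^b = v^(a + b). *)
Definition laurent : Type := {freeg int}.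
HB.instance Definition _ := GRing.Lmodule.on laurent.

Definition vpow (k : int) : laurent := << k >>.

Definition laurent_mul (p q : laurent) : laurent :=
  fglift (fun a => fglift (fun b => vpow (a + b)) q) p.

Lemma laurent_mulC : commutative laurent_mul.
Proof.
move=> p q; rewrite /laurent_mul fglift_exchange.
by congr (fglift _ _); apply/funext => a; congr (fglift _ _); apply/funext => b;
   rewrite addrC.
Qed.

Lemma laurent_mulDl : left_distributive laurent_mul +%R.
Proof. by move=> p q r; rewrite /laurent_mul raddfD. Qed.

Lemma laurent_mul1 : left_id (vpow 0) laurent_mul.
Proof.
move=> p; rewrite /laurent_mul fgliftU1.
apply: (@additive_freeg_eq _ _ (fglift (fun b => vpow (0 + b))) idfun).
by move=> k /=; rewrite fgliftU1 add0r.
Qed.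

Lemma fglift_comp (K L : choiceType) (M : lmodType int) (f : L -> M)
   (g : K -> {freeg L}) p : fglift f (fglift g p) = fglift (fglift f \o g) p.
Proof.
apply: (@additive_freeg_eq _ _ (fglift f \o fglift g) (fglift (fglift f \o g))).
by move=> k /=; rewrite !fgliftU1.
Qed.

Lemma laurent_mulA : associative laurent_mul.
Proof.
move=> p q r; rewrite /laurent_mul fglift_comp; congr (fglift _ p).
apply/funext => a /=; rewrite !fglift_comp; congr (fglift _ q).
apply/funext => b /=; rewrite fgliftU1 fglift_comp; congr (fglift _ r).
by apply/funext => c /=; rewrite fgliftU1 addrA.
Qed.

Lemma laurent_1neq0 : vpow 0 != 0 :> laurent.
Proof. by rewrite freegU_eq0. Qed.

HB.instance Definition _ := GRing.Zmodule_isComNzRing.Build laurent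
  laurent_mulA laurent_mulC laurent_mul1 laurent_mulDl laurent_1neq0.

Lemma vpowD a b : vpow (a + b) = vpow a * vpow b.
Proof. by rewrite /GRing.mul /= /laurent_mul !fgliftU1. Qed.

Definition vbar : laurent -> laurent := fglift (fun k => vpow (- k)).
HB.instance Definition _ := GRing.Additive.on vbar.

Lemma vbar_vpow k : vbar (vpow k) = vpow (- k).
Proof. exact: fgliftU1. Qed.

Lemma vbar_is_monoid_morphism : monoid_morphism vbar.
Proof.
split=> [|p q]; first by rewrite [LHS]vbar_vpow oppr0.
rewrite /GRing.mul /= /laurent_mul /vbar !fglift_comp; congr (fglift _ p).
apply/funext => a /=; rewrite fgliftU1 !fglift_comp; congr (fglift _ q).
by apply/funext => b /=; rewrite !fgliftU1 opprD.
Qed.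
HB.instance Definition _ :=
  GRing.isMonoidMorphism.Build laurent laurent vbar vbar_is_monoid_morphism.

Section Rmod.
Variable m : nat.

(* the ideal (v^m - 1) of Z[v, v^-1] *)
Definition vpow_ideal : {pred laurent} :=
  [pred p : laurent | `[< exists q, p = (vpow m - 1) * q >]].

Lemma deg_mul (p q : laurent) : deg (p * q) = deg p * deg q.
Proof.
have inner a : deg (fglift (fun b => vpow (a + b)) q) = deg q.
  rewrite /deg fglift_comp /comp.
  by under eq_fun do rewrite fgliftU1.
rewrite [in LHS]/deg [p * q]/(laurent_mul p q) fglift_comp /comp.
under eq_fun do rewrite -/(deg _) inner.
rewrite fgliftE /deg [in RHS]fgliftE mulr_suml; apply: eq_bigr => a _.
by rewrite /GRing.scale /= mulr1.
Qed.

Lemma vpow_ideal_closed : idealr_closed vpow_ideal.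
Proof.
split=> [||a _ _ /asboolP[p ->] /asboolP[q ->]].
- by apply/asboolP; exists 0; rewrite mulr0.
- apply/asboolP => -[q /(congr1 (@deg _))].
  by rewrite deg_mul raddfB /= !degU subrr mul0r.
- by apply/asboolP; exists (a * p + q); rewrite mulrDr mulrCA.
Qed.

HB.instance Definition _ := isIdealr.Build laurent vpow_ideal vpow_ideal_closed.

(* R_m, with vmon k the class of v^k and Rbar the substitution v -> v^-1 *)
Definition Rmod : Type := {ideal_quot vpow_ideal}.
HB.instance Definition _ := GRing.ComNzRing.on Rmod.

Definition vmon (k : int) : Rmod := \pi_{ideal_quot vpow_ideal} (vpow k).
Definition Rbar (p : Rmod) : Rmod :=
  \pi_{ideal_quot vpow_ideal} (vbar (repr (p : {ideal_quot vpow_ideal}))).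

Lemma vbar_ideal p : p \in vpow_ideal -> vbar p \in vpow_ideal.
Proof.
move=> /asboolP[q ->]; apply/asboolP; exists (- vpow (- (m : int)) * vbar q).
rewrite rmorphM rmorphB rmorph1 /= vbar_vpow mulrA; congr (_ * _).
by rewrite mulrN mulrBl -vpowD addrN mul1r opprB.
Qed.

Lemma Rbar_pi p :
  Rbar (\pi_{ideal_quot vpow_ideal} p) = \pi_{ideal_quot vpow_ideal} (vbar p).
Proof.
apply/eqP; rewrite /Rbar -Quotient.idealrBE -rmorphB vbar_ideal //.
by rewrite Quotient.idealrBE reprK.
Qed.

Lemma vmon_period (k : int) : vmon (k + m) = vmon k.
Proof.
apply/eqP; rewrite /vmon -Quotient.idealrBE; apply/asboolP; exists (vpow k).
by rewrite [k + _]addrC vpowD mulrBl mul1r.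
Qed.

End Rmod.

Arguments vmon m k : clear implicits.

(* the symbols x^p, p in the disjoint union of the R_m *)
Definition xsymbol : Type := {m : nat & Rmod m}.
HB.instance Definition _ := Choice.on xsymbol.

Definition xpow (m : nat) (p : Rmod m) : xsymbol := Tagged Rmod p.

Definition inv_x : {freeg xsymbol} -> {freeg xsymbol} :=
  fglift (fun s => << xpow (- tagged s) >>).
Definition inv_v : {freeg xsymbol} -> {freeg xsymbol} :=
  fglift (fun s => << xpow (Rbar (tagged s)) >>).

Section Curves.
Variable R : realType.
Implicit Types (f : R -> 'rV[R]_2) (s t : R).

Definition det2 (u v : 'rV[R]_2) : R := \det (col_mx u v : 'M[R]_2).
Definition positive_basis (u v : 'rV[R]_2) : bool := 0 < det2 u v.

Lemma det2E u v : det2 u v = u 0 0 * v 0 1 - u 0 1 * v 0 0.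
Proof.
have c0 j : (col_mx u v : 'M[R]_2) 0 j = u 0 j.
  by rewrite -(col_mxEu u v); congr (fun_of_matrix _ _ j); exact/val_inj.
have c1 j : (col_mx u v : 'M[R]_2) 1 j = v 0 j.
  by rewrite -(col_mxEd u v); congr (fun_of_matrix _ _ j); exact/val_inj.
have l01 : fintype.lift 0 0 = 1 :> 'I_2 by exact/val_inj.
have l10 : fintype.lift 1 0 = 0 :> 'I_2 by exact/val_inj.
rewrite /det2; move: (col_mx u v : 'M[R]_2) c0 c1 => A c0 c1.
rewrite (expand_det_row _ 0) big_ord_recl big_ord1 /cofactor !det_mx11 !mxE.
rewrite !l01 !l10 !c0 !c1 /= add0n expr0 expr1.
by rewrite mul1r mulN1r mulrN.
Qed.

Lemma det2C u v : det2 v u = - det2 u v.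
Proof. by rewrite !det2E opprB mulrC [v 0 1 * _]mulrC. Qed.

Lemma det2NN u v : det2 (- u) (- v) = det2 u v.
Proof. by rewrite !det2E !mxE !mulrNN. Qed.

Definition double_pair f s t : Prop :=
  [/\ s \in `[0, 1], t \in `[0, 1], s != t & f s = f t].

(* Only the restriction of [curve] to [0, 1] and the trace of [over] on the
   preimages of double points matter: every C^1 map on [0, 1] extends to the
   line, and the extension does not affect the derivative on [0, 1]. *)
Record knotoid_diagram := KnotoidDiagram {
  curve : R -> 'rV[R]_2;
  over : set R;
  curve_derivable : forall t, derivable curve t 1;
  curve_C1 : continuous (derive1 curve);
  curve_immersed : forall t, t \in `[0, 1] -> derive1 curve t != 0;
  double_finite : finite_set [set st | double_pair curve st.1 st.2];
  double_unique : forall s t t',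
    double_pair curve s t -> double_pair curve s t' -> t = t';
  double_interior : forall s t, double_pair curve s t -> 0 < s < 1;
  double_transverse : forall s t, double_pair curve s t ->
    det2 (derive1 curve s) (derive1 curve t) != 0;
  over_xor_under : forall s t, double_pair curve s t -> over s <-> ~ over t
}.

Lemma is_derive_reverse f t : derivable f (1 - t) 1 ->
  is_derive t 1 (fun t => f (1 - t)) (- derive1 f (1 - t)).
Proof.
move=> /derivable1_diffP df.
have dr : is_diff t (fun t : R => 1 - t) (fun h : R => - h).
  have -> : (fun h : R => - h) = 0 - (@idfun R).
    by apply/funext => h; rewrite /= sub0r.
  exact: is_diffB.
have df' : is_diff (1 - t) f ('d f (1 - t)) by exact: DiffDef.
have dc : is_diff t (f \o (fun t => 1 - t)) ('d f (1 - t) \o (fun h : R => - h)).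
  exact: is_diff_comp.
have ddc : differentiable (f \o (fun t => 1 - t)) t by case: dc.
apply: DeriveDef; first exact/derivable1_diffP.
rewrite deriveE //.
have -> : 'd (f \o (fun t => 1 - t)) t = ('d f (1 - t) \o (fun h : R => - h)) :> (_ -> _).
  exact: diff_val.
by rewrite /= linearN derive1E'.
Qed.

Lemma derive1_reverse (D : knotoid_diagram) t :
  derive1 (fun t => curve D (1 - t)) t = - derive1 (curve D) (1 - t).
Proof.
rewrite derive1E.
by have [_ ->] := is_derive_reverse (@curve_derivable D (1 - t)).
Qed.

Lemma double_pair_reverse f s t :
  double_pair (fun t => f (1 - t)) s t <-> double_pair f (1 - s) (1 - t).
Proof.
have I01 (x : R) : (1 - x \in `[0, 1]) = (x \in `[0, 1]).
  by rewrite !in_itv /= subr_ge0 lerBlDr lerDl andbC.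
have N : (1 - s != 1 - t) = (s != t) by rewrite (inj_eq (addrI _)) eqr_opp.
by rewrite /double_pair !I01 N.
Qed.

Lemma double_pair_sym f s t : double_pair f s t -> double_pair f t s.
Proof. by case=> ? ? ? ?; split; rewrite // eq_sym. Qed.

Program Definition inverse (D : knotoid_diagram) : knotoid_diagram :=
  @KnotoidDiagram (fun t => curve D (1 - t)) [set t | over D (1 - t)]
    _ _ _ _ _ _ _ _.
Next Obligation.
by move=> D t; have [] := is_derive_reverse (@curve_derivable D (1 - t)).
Qed.
Next Obligation.
move=> D.
have -> : derive1 (fun t => curve D (1 - t)) =
          (fun t => - derive1 (curve D) (1 - t)).
  by apply/funext => t; exact: derive1_reverse.
move=> t; apply: cvgN.
apply: (@continuous_comp _ _ _ (fun t : R => 1 - t)); last exact: curve_C1.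
by apply: cvgB; [exact: cvg_cst | exact: cvg_id].
Qed.
Next Obligation.
move=> D t t01; rewrite derive1_reverse oppr_eq0; apply: curve_immersed.
by move: t01; rewrite !in_itv /= subr_ge0 lerBlDr lerDl andbC.
Qed.
Next Obligation.
move=> D; pose r (st : R * R) := (1 - st.1, 1 - st.2).
apply: (@sub_finite_set _ _ (r @` [set st | double_pair (curve D) st.1 st.2])).
  move=> [s t] /double_pair_reverse st; exists (1 - s, 1 - t) => //=.
  by rewrite /r /= !subKr.
exact/finite_image/double_finite.
Qed.
Next Obligation.
move=> D s t t' /double_pair_reverse st /double_pair_reverse st'.
by have /addrI/oppr_inj := double_unique st st'.
Qed.
Next Obligation.
move=> D s t /double_pair_reverse/double_interior.
by rewrite subr_gt0 ltrBlDr ltrDl andbC.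
Qed.
Next Obligation.
move=> D s t /double_pair_reverse/double_transverse.
by rewrite !derive1_reverse det2NN.
Qed.
Next Obligation.
by move=> D s t /double_pair_reverse/over_xor_under.
Qed.

Variable D : knotoid_diagram.

Definition tangent t : 'rV[R]_2 := derive1 (curve D) t.

(* A crossing, and the corresponding chord of the Gauss diagram, is the pair of
   its over- and under-preimages, in this order. *)
Definition crossings : set (R * R) :=
  [set c | double_pair (curve D) c.1 c.2 /\ over D c.1].

Implicit Types c e : R * R.

Definition sgn c : int :=
  if positive_basis (tangent c.1) (tangent c.2) then 1 else -1.

Definition passages : set R := [set t | exists s, double_pair (curve D) t s].

(* The components of D \ C(D) are travelled one after the other, separated by
   the passages through crossings (two per crossing), hence are numbered from 0
   to num_passages by the number of passages preceding them; arc_in t and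
   arc_out t are the arcs ending and starting at the passage at time t.  A
   labelling of the arcs is a function nat -> int, whose values beyond
   num_passages are irrelevant. *)
Definition arc_in t : nat := #|` fset_set (passages `&` [set s | s < t])|.
Definition arc_out t : nat := (arc_in t).+1.

(* At a double point f t = f s, the strand at time t crosses the strand at time
   s from right to left when it heads to the left of the latter. *)
Definition right_to_left t s : bool := positive_basis (tangent s) (tangent t).

Definition cheng_coloring (a : nat -> int) : Prop :=
  forall t s, double_pair (curve D) t s ->
    a (arc_out t) = if right_to_left t s then a (arc_in t) + 1
                    else a (arc_in t) - 1.

Lemma finite_passages : finite_set passages.
Proof.
apply: (@sub_finite_set _ _ (fst @` [set st | double_pair (curve D) st.1 st.2])).
  by move=> t [s ts]; exists (t, s).
exact/finite_image/double_finite.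
Qed.

Lemma finite_passages_lt t : finite_set (passages `&` [set s | s < t]).
Proof. exact/finite_setIl/finite_passages. Qed.

Lemma arc_in_lt t t' : t < t' -> passages t -> (arc_in t < arc_in t')%N.
Proof.
move=> tt' pt; apply: (@fset_set_ltn_card _ _ _ t).
- exact: finite_passages_lt.
- by move=> s [ps /= st]; split=> //=; exact: lt_trans tt'.
- by split.
- by case; rewrite /= ltxx.
Qed.

Lemma arc_in_inj t t' : passages t -> passages t' -> arc_in t = arc_in t' -> t = t'.
Proof.
move=> pt pt' E; case: (ltgtP t t') => // lt.
  by have := arc_in_lt lt pt; rewrite E ltnn.
by have := arc_in_lt lt pt'; rewrite E ltnn.
Qed.

Lemma cheng_coloring_exists : exists a, cheng_coloring a.
Proof.
pose up k := `[< exists t s, [/\ double_pair (curve D) t s, arc_in t = k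
                                & right_to_left t s] >].
exists (fun n => \sum_(k < n) (if up k then 1 else -1)) => t s ts.
rewrite /arc_out big_ord_recr /=.
have -> : up (arc_in t) = right_to_left t s.
  apply/asboolP/idP => [[t' [s' [ts' E]]]|rl]; last by exists t, s.
  have tt' : t' = t by apply: arc_in_inj => //; [exists s'|exists s].
  by move: ts'; rewrite tt' => /(@double_unique D _ _ _ ts) ->.
by case: ifP.
Qed.

(* a(incoming arc of the strand crossing from right to left) minus
   a(outgoing arc of the other strand) *)
Definition chord_index (a : nat -> int) c : int :=
  if right_to_left c.1 c.2 then a (arc_in c.1) - a (arc_out c.2)
  else a (arc_in c.2) - a (arc_out c.1).

Definition num_passages : nat := #|` fset_set passages|.

Lemma arc_out_le t : passages t -> (arc_out t <= num_passages)%N.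
Proof.
move=> pt; apply: (@fset_set_ltn_card _ _ _ t) => //.
- exact: finite_passages.
- by case; rewrite /= ltxx.
Qed.

Lemma arc_in_surj k : (k < num_passages)%N -> exists2 t, passages t & arc_in t = k.
Proof.
move=> kN; pose P := fset_set passages.
have inP s : (s \in P) = (s \in passages).
  by rewrite in_fset_set //; exact: finite_passages.
pose ranks := [seq arc_in s | s <- P].
have sub : {subset ranks <= iota 0 num_passages}.
  move=> _ /mapP[s + ->]; rewrite mem_iota add0n /= inP => /set_mem.
  exact: arc_out_le.
have ur : uniq ranks.
  rewrite map_inj_in_uniq ?fset_uniq // => x y.
  by rewrite !inP => /set_mem px /set_mem; exact: arc_in_inj.
have sz : (size (iota 0 num_passages) <= size ranks)%N by rewrite size_iota size_map.
have [_ E] := uniq_min_size ur sub sz.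
have : k \in ranks by rewrite E mem_iota.
by case/mapP => t; rewrite inP => /set_mem pt ->; exists t.
Qed.

Lemma cheng_coloring_unique a a' : cheng_coloring a -> cheng_coloring a' ->
  forall k, (k <= num_passages)%N -> a k - a' k = a 0%N - a' 0%N.
Proof.
move=> ca ca'; elim=> [//|k IH] kN; rewrite -(IH (ltnW kN)).
have [t [s ts] <-] := arc_in_surj kN.
by rewrite -/(arc_out t) (ca _ _ ts) (ca' _ _ ts); case: ifP => _; lia.
Qed.

Lemma chord_index_unique a a' c : cheng_coloring a -> cheng_coloring a' ->
  crossings c -> chord_index a c = chord_index a' c.
Proof.
move=> ca ca' [cd _].
have p1 : passages c.1 by exists c.2.
have p2 : passages c.2 by exists c.1; exact: double_pair_sym.
have H := cheng_coloring_unique ca ca'.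
have := H _ (arc_out_le p1); have := H _ (arc_out_le p2).
have := H _ (ltnW (arc_out_le p1)); have := H _ (ltnW (arc_out_le p2)).
by rewrite /chord_index; case: ifP => _; lia.
Qed.

Definition u c : int := chord_index (projT1 (cid cheng_coloring_exists)) c.

(* ccw x y z: going around the circle counterclockwise from x, one meets y
   strictly before z.  The counterclockwise arc from the starting point to the
   end point of an oriented chord lies on its right, and the gap between head
   and leg is not a point of [0, 1], so cyclic order decides the sides. *)
Definition ccw (x y z : R) : bool :=
  [|| (x < y) && (y < z), (y < z) && (z < x) | (z < x) && (x < y)].

Definition right_side c : set R := [set t | ccw c.1 t c.2].
Definition left_side c : set R := [set t | ccw c.2 t c.1].

Definition lead_side c : set R :=
  if ccw c.1 0 c.2 then right_side c else left_side c.
Definition other_side c : set R :=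
  if ccw c.1 0 c.2 then left_side c else right_side c.

Definition chords_from_to (A B : set R) : set (R * R) :=
  [set e | [/\ crossings e, A e.1 & B e.2]].

Definition right_chords c := chords_from_to (left_side c) (right_side c).
Definition left_chords c := chords_from_to (right_side c) (left_side c).
Definition lambda_chords c := chords_from_to (other_side c) (lead_side c).
Definition rho_chords c := chords_from_to (lead_side c) (other_side c).

Definition degree c : int :=
  \sum_(e \in right_chords c) sgn e - \sum_(e \in left_chords c) sgn e.

Definition intersection_index c : int :=
  \sum_(e \in [set e | crossings e /\ lead_side c e.1]) sgn e +
  \sum_(e \in [set e | crossings e /\ lead_side c e.2]) (- sgn e).

Definition phi c (k : int) : int := (k %% `|degree c|%N)%Z.

Definition index_function c (A B : set (R * R)) (w : R * R -> int) :
    Rmod `|degree c|%N :=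
  \sum_(e \in A) (sgn e)%:~R * vmon `|degree c|%N (phi c (w e)) -
  \sum_(e \in B) (sgn e)%:~R * vmon `|degree c|%N (phi c (- w e)).

Definition g_index c := index_function c (right_chords c) (left_chords c) degree.
Definition h_index c := index_function c (rho_chords c) (lambda_chords c) degree.
Definition gt_index c := index_function c (right_chords c) (left_chords c) intersection_index.
Definition ht_index c := index_function c (rho_chords c) (lambda_chords c) intersection_index.

Definition B_phase : {freeg xsymbol} :=
  \sum_(c \in crossings) << u c *g xpow (g_index c) >>.
Definition C_phase : {freeg xsymbol} :=
  \sum_(c \in crossings) << u c *g xpow (h_index c) >>.
Definition Bt_phase : {freeg xsymbol} :=
  \sum_(c \in crossings) << u c *g xpow (gt_index c) >>.
Definition Ct_phase : {freeg xsymbol} :=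
  \sum_(c \in crossings) << u c *g xpow (ht_index c) >>.

End Curves.

(* Main.v *)
(** Reversing the orientation sends the parameter t to 1 - t.  Signs of crossings
    and the lead side of a chord are preserved while the two sides of every chord
    are exchanged; so degrees change sign, intersection indices are preserved,
    r and l are exchanged, and rho and lambda are preserved.  Reading a Cheng
    coloring backwards and negating it gives a Cheng coloring of -D, whence
    u changes sign. *)
Require Import Defs.
From HB Require Import structures.
From mathcomp Require Import all_boot all_order all_algebra.
From mathcomp Require Import ring_quotient generic_quotient.
From mathcomp Require Import all_classical all_reals all_analysis.
From mathcomp Require Import finmap zify.
From mathcomp.multinomials Require Import freeg.
Import Order.TTheory GRing.Theory Num.Theory.

Local Open Scope classical_set_scope.
Local Open Scope ring_scope.
Local Open Scope quotient_scope.

(** * Substitutions in [x] and [v], and finite sums over sets *)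

HB.instance Definition _ := GRing.Additive.on inv_x.
HB.instance Definition _ := GRing.Additive.on inv_v.

Lemma inv_x_xpow (m : nat) (p : Rmod m) : inv_x << xpow p >> = << xpow (- p) >>.
Proof. exact: fgliftU1. Qed.

Lemma inv_v_xpow (m : nat) (p : Rmod m) : inv_v << xpow p >> = << xpow (Rbar p) >>.
Proof. exact: fgliftU1. Qed.

Lemma raddf_fsum {T : choiceType} {U V : zmodType} (f : {additive U -> V})
    (A : set T) (F : T -> U) : finite_set A ->
  f (\sum_(x \in A) F x) = \sum_(x \in A) f (F x).
Proof. by move=> finA; rewrite !fsbig_finite // raddf_sum. Qed.

Lemma reindex_fsum_involutive {T : choiceType} {V : nmodType} (A : set T)
    {r : T -> T} (F : T -> V) : involutive r ->
  \sum_(x \in r @^-1` A) F x = \sum_(x \in A) F (r x).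
Proof.
move=> rK; apply: reindex_fsbig; split.
- by move=> x Ax /=; rewrite rK.
- by move=> x y _ _; exact: inv_inj.
- by move=> x Ax; exists (r x); rewrite ?rK.
Qed.

Lemma fsum_preimage_involutive {T : choiceType} {V : nmodType} (A : set T)
    {r : T -> T} (F : T -> V) : involutive r ->
  \sum_(x \in r @^-1` A) (F \o r) x = \sum_(x \in A) F x.
Proof.
move=> rK; rewrite (reindex_fsum_involutive A _ rK).
by apply: eq_fsbigr => x _ /=; rewrite rK.
Qed.

(** Turns arc numbers, defined as cardinals, into sums that can be reindexed along the reflection of
    the interval. *)
Lemma card_fset_set {T : choiceType} (A : set T) : finite_set A ->
  #|` fset_set A|%fset = \sum_(x \in A) 1%N.
Proof. by move=> finA; rewrite fsbig_finite //= card_fset_sum1. Qed.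

(** * Signed sums of monomials in [Rmod m] *)

Section Rmod.
Context {m : nat}.

Lemma Rbar_is_zmod_morphism : zmod_morphism (@Rbar m).
Proof.
move=> p q; rewrite -[p]reprK -[q]reprK -raddfB.
by rewrite !Rbar_pi !raddfB.
Qed.
HB.instance Definition _ :=
  GRing.isZmodMorphism.Build (Rmod m) (Rmod m) (@Rbar m) Rbar_is_zmod_morphism.

Lemma Rbar_vmon k : Rbar (vmon m k) = vmon m (- k).
Proof. by rewrite /vmon Rbar_pi vbar_vpow. Qed.

Lemma vmon_modz k : vmon m (k %% m)%Z = vmon m k.
Proof.
have per (j l : int) : vmon m (l + j * m%:Z) = vmon m l.
  elim/int_ind: j l => [|n IH|n IH] l; first by rewrite mul0r addr0.
  - by rewrite intS mulrDl mul1r addrA IH vmon_period.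
  (* In the downward step a period is added on the left to reach the induction hypothesis. *)
  - rewrite -(vmon_period m (l + _)) -[RHS]IH; congr (vmon m _).
    by rewrite intS; lia.
by rewrite -(per (k %/ m)%Z) addrC -divz_eq.
Qed.

Context {T : choiceType}.
Implicit Types (s w : T -> int) (A B : set T).

(** Common shape of the four index functions, with unreduced exponents and a modulus [m] that is not
    tied to a chord. *)
Definition index_sum s A B w : Rmod m :=
  \sum_(e \in A) (s e)%:~R * vmon m (w e) -
  \sum_(e \in B) (s e)%:~R * vmon m (- w e).

(** Negating the weight exchanges the exponents [w e] and [- w e] of the two sums, so only their
    order in the difference is affected. *)
Lemma index_sum_swap s A B w :
  index_sum s A B (fun e => - w e) = - index_sum s B A w.
Proof.
rewrite /index_sum opprB; congr (_ - _).
by under eq_fsbigr do rewrite opprK.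
Qed.

Lemma Rbar_index_sum s A B w : finite_set A -> finite_set B ->
  Rbar (index_sum s A B w) = index_sum s A B (fun e => - w e).
Proof.
have E C (f : T -> int) : finite_set C ->
    Rbar (\sum_(e \in C) (s e)%:~R * vmon m (f e)) =
    \sum_(e \in C) (s e)%:~R * vmon m (- f e).
  move=> finC; rewrite raddf_fsum //; apply: eq_fsbigr => e _.
  by rewrite !mulrzl raddfMz /= Rbar_vmon.
by move=> finA finB; rewrite /index_sum raddfB /= !E.
Qed.

Lemma index_sum_preimage s A B w {r : T -> T} : involutive r ->
  index_sum (s \o r) (r @^-1` A) (r @^-1` B) (w \o r) = index_sum s A B w.
Proof.
move=> rK; rewrite /index_sum.
by rewrite (fsum_preimage_involutive A (fun e => (s e)%:~R * vmon m (w e)) rK)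
  (fsum_preimage_involutive B (fun e => (s e)%:~R * vmon m (- w e)) rK).
Qed.

End Rmod.

(** * Crossings and signs of the inverse diagram *)

Section Inverse.
Context {R : realType}.
Implicit Types (D : knotoid_diagram R) (c e : R * R) (t s : R).

(** The components keep their order because over-preimages remain over-preimages in [inverse D]. *)
Definition reverse_chord c : R * R := (1 - c.1, 1 - c.2).

Lemma reverse_chordK : involutive reverse_chord.
Proof. by case=> a b; rewrite /reverse_chord /= !subKr. Qed.

Lemma tangent_inverse D t : tangent (inverse D) t = - tangent D (1 - t).
Proof. exact: derive1_reverse. Qed.

Lemma crossings_inverse D : crossings (inverse D) = reverse_chord @^-1` crossings D.
Proof.
apply/seteqP; split=> c [/= dc oc]; split=> //=.
  exact/double_pair_reverse.
exact/double_pair_reverse.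
Qed.

(** Both tangents are negated, which leaves their determinant unchanged. *)
Lemma sgn_inverse D : sgn (inverse D) = sgn D \o reverse_chord.
Proof.
by apply/funext => c; rewrite /sgn /positive_basis !tangent_inverse det2NN.
Qed.

Lemma right_to_left_inverse D t s :
  right_to_left (inverse D) t s = right_to_left D (1 - t) (1 - s).
Proof. by rewrite /right_to_left /positive_basis !tangent_inverse det2NN. Qed.

(** * Passages, arc numbers and Cheng colorings *)

Lemma passages_inverse D t : passages (inverse D) t <-> passages D (1 - t).
Proof.
split=> [[s /double_pair_reverse ts]|[s ts]]; first by exists (1 - s).
by exists (1 - s); apply/double_pair_reverse; rewrite subKr.
Qed.

Lemma passages_inverse_lt D t :
  passages (inverse D) `&` [set s | s < t] =
  (fun s => 1 - s) @^-1` (passages D `&` [set s | 1 - t < s]).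
Proof.
by apply/seteqP; split=> s [/passages_inverse ps /= st]; split=> //=;
  [rewrite ltrD2l ltrN2 | move: st; rewrite ltrD2l ltrN2].
Qed.

(** The passages of [inverse D] before [t] are those of [D] after [1 - t]; [arc_out] accounts for
    those before [1 - t] and for [1 - t] itself. *)
Lemma num_passages_arc_in_inverse D t : passages D (1 - t) ->
  (arc_in (inverse D) t + arc_out D (1 - t))%N = num_passages D.
Proof.
move=> pt; have finD := finite_passages D.
have subK : involutive (fun s : R => 1 - s) by move=> s; rewrite subKr.
rewrite /arc_out /arc_in /num_passages passages_inverse_lt.
rewrite !card_fset_set; last first.
- by rewrite -passages_inverse_lt; exact: finite_passages_lt.
- exact: finite_passages_lt.
- by [].
rewrite (reindex_fsum_involutive _ _ subK) !fsbig_mkcondr.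
(* The passage [1 - t] lies in neither strict half; its term in [num_passages] matches the successor
   in [arc_out]. *)
rewrite !(fsbigD1 (1 - t) (passages D)) //= !memNset /= ?ltxx //.
rewrite !add0r addnS -addSn addSn addnE -[RHS]add1n; congr _.+1.
apply: etrans (esym (fsbig_split (+%R : Monoid.com_law 0) _ _ (finite_setD _ finD))) _.
(* Every other passage lies in exactly one of the two halves. *)
apply: eq_fsbigr => s /set_mem[_ /= /eqP st].
have mem (P : pred R) : (s \in [set x | P x]) = P s by apply/idP/idP; rewrite in_setE.
by rewrite !mem; case: (ltgtP s (1 - t)) st.
Qed.

Lemma arc_in_inverse D t : passages D (1 - t) ->
  arc_in (inverse D) t = (num_passages D - arc_out D (1 - t))%N.
Proof. by move=> /num_passages_arc_in_inverse <-; rewrite addnK. Qed.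

Lemma arc_out_inverse D t : passages D (1 - t) ->
  arc_out (inverse D) t = (num_passages D - arc_in D (1 - t))%N.
Proof.
by move=> /num_passages_arc_in_inverse <-; rewrite /arc_out addnS -addSn addnK.
Qed.

(** Reversing both strands preserves [right_to_left] but exchanges incoming and outgoing arcs, so
    the jump at a passage changes sign; negating the labels restores it. *)
Lemma cheng_coloring_inverse D a : cheng_coloring D a ->
  cheng_coloring (inverse D) (fun k => - a (num_passages D - k)%N).
Proof.
move=> ca t s /double_pair_reverse ts.
have pt : passages D (1 - t) by exists (1 - s).
rewrite arc_in_inverse // arc_out_inverse // right_to_left_inverse.
(* The bounds on arc numbers make the truncated subtraction from [num_passages] involutive. *)
rewrite !subKn ?arc_out_le ?(ltnW (arc_out_le pt)) //.
by rewrite (ca _ _ ts); case: right_to_left; lia.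
Qed.

(** With the reversed coloring, incoming and outgoing arcs trade places; one of the two passages
    raises the label and the other lowers it, and these shifts cancel in the difference. *)
Lemma u_inverse D c : crossings D (reverse_chord c) ->
  u (inverse D) c = - u D (reverse_chord c).
Proof.
move=> Dc; rewrite /u; case: cid => a' ca' /=; case: cid => a ca /=.
have Dc' : crossings (inverse D) c by rewrite crossings_inverse.
(* The coloring chosen for [inverse D] may differ from the reversed one, but both give the same
   chord index. *)
rewrite (chord_index_unique ca' (cheng_coloring_inverse _ _ ca) Dc').
have [dc _] := Dc.
have p1 : passages D (1 - c.1) by exists (1 - c.2).
have p2 : passages D (1 - c.2) by exists (1 - c.1); exact: double_pair_sym dc.
rewrite /chord_index right_to_left_inverse !arc_in_inverse // !arc_out_inverse //.
rewrite !subKn ?arc_out_le ?(ltnW (arc_out_le p1)) ?(ltnW (arc_out_le p2)) //=.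
have E1 := ca _ _ dc; have E2 := ca _ _ (double_pair_sym dc).
move: E1 E2 (double_transverse dc); rewrite /= /right_to_left /positive_basis.
rewrite -/(tangent D _) -/(tangent D _).
move: (tangent D (1 - c.1)) (tangent D (1 - c.2)) => v w.
(* Antisymmetry of [det2] makes the two passages cross in opposite directions; transversality
   excludes a zero determinant. *)
by rewrite [det2 v w]det2C oppr_gt0 oppr_eq0; case: ltgtP => // _ -> -> _; lia.
Qed.

(** * Sides of chords and the chords crossing them *)

Lemma ccw_reverse t s x : ccw (1 - t) (1 - s) (1 - x) = ccw x s t.
Proof.
rewrite /ccw !ltrD2l !ltrN2.
by case: (s < t); case: (x < s); case: (t < x).
Qed.

Lemma right_side_inverse c t :
  right_side c t = left_side (reverse_chord c) (1 - t).
Proof. by rewrite /left_side /right_side /= ccw_reverse. Qed.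

Lemma left_side_inverse c t :
  left_side c t = right_side (reverse_chord c) (1 - t).
Proof. by rewrite /left_side /right_side /= ccw_reverse. Qed.

(** The endpoints of [c] lie strictly between 0 and 1, so [ccw c.1 0 c.2] amounts to [c.2 < c.1];
    reflection reverses this comparison of distinct numbers. *)
Lemma ccw_leg_reverse D c : crossings D c ->
  ccw (reverse_chord c).1 0 (reverse_chord c).2 = ~~ ccw c.1 0 c.2.
Proof.
move=> [dc _]; have [_ _ + _] := dc.
have /andP[c1 c1'] := double_interior dc.
have /andP[c2 c2'] := double_interior (double_pair_sym dc).
rewrite /ccw /= subr_gt0 !subr_lt0 ltrD2l ltrN2 c2 c2'.
rewrite (lt_gtF c1) (lt_gtF c1') /= !andbF !orbF.
by case: ltgtP.
Qed.

(** The test that selects the side and the two sides themselves are both flipped, and the flips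
    cancel. *)
Lemma lead_side_inverse D c t : crossings D (reverse_chord c) ->
  lead_side c t = lead_side (reverse_chord c) (1 - t).
Proof.
move=> /ccw_leg_reverse; rewrite reverse_chordK /lead_side => ->.
by case: ccw; [exact: left_side_inverse | exact: right_side_inverse].
Qed.

Lemma other_side_inverse D c t : crossings D (reverse_chord c) ->
  other_side c t = other_side (reverse_chord c) (1 - t).
Proof.
move=> /ccw_leg_reverse; rewrite reverse_chordK /other_side => ->.
by case: ccw; [exact: right_side_inverse | exact: left_side_inverse].
Qed.

Lemma chords_from_to_inverse D (A B A' B' : set R) :
  (forall t, A t = A' (1 - t)) -> (forall t, B t = B' (1 - t)) ->
  chords_from_to (inverse D) A B = reverse_chord @^-1` chords_from_to D A' B'.
Proof.
move=> AA BB; rewrite /chords_from_to crossings_inverse.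
by apply/seteqP; split=> e /=; rewrite AA BB.
Qed.

Lemma right_chords_inverse D c :
  right_chords (inverse D) c = reverse_chord @^-1` left_chords D (reverse_chord c).
Proof.
by apply: chords_from_to_inverse => t;
  [exact: left_side_inverse | exact: right_side_inverse].
Qed.

Lemma left_chords_inverse D c :
  left_chords (inverse D) c = reverse_chord @^-1` right_chords D (reverse_chord c).
Proof.
by apply: chords_from_to_inverse => t;
  [exact: right_side_inverse | exact: left_side_inverse].
Qed.

Lemma rho_chords_inverse D c : crossings D (reverse_chord c) ->
  rho_chords (inverse D) c = reverse_chord @^-1` rho_chords D (reverse_chord c).
Proof.
by move=> Dc; apply: chords_from_to_inverse => t;
  [exact: lead_side_inverse Dc | exact: other_side_inverse Dc].
Qed.

Lemma lambda_chords_inverse D c : crossings D (reverse_chord c) ->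
  lambda_chords (inverse D) c = reverse_chord @^-1` lambda_chords D (reverse_chord c).
Proof.
by move=> Dc; apply: chords_from_to_inverse => t;
  [exact: other_side_inverse Dc | exact: lead_side_inverse Dc].
Qed.

(** * Degree and intersection index *)

Lemma degree_inverse D c : degree (inverse D) c = - degree D (reverse_chord c).
Proof.
rewrite /degree right_chords_inverse left_chords_inverse sgn_inverse.
move: (left_chords D _) (right_chords D _) (sgn D) => A B s.
by rewrite (fsum_preimage_involutive A s reverse_chordK)
           (fsum_preimage_involutive B s reverse_chordK) opprB.
Qed.

Lemma intersection_index_inverse D c : crossings D (reverse_chord c) ->
  intersection_index (inverse D) c = intersection_index D (reverse_chord c).
Proof.
move=> Dc; rewrite /intersection_index sgn_inverse.
have E (f : R * R -> R) : (forall e, f (reverse_chord e) = 1 - f e) ->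
  [set e | crossings (inverse D) e /\ lead_side c (f e)] =
  reverse_chord @^-1` [set e | crossings D e /\ lead_side (reverse_chord c) (f e)].
  move=> fr; rewrite crossings_inverse; apply/funext => e /=.
  by rewrite (lead_side_inverse _ _ (f e) Dc) fr.
rewrite (E fst (fun=> erefl)) (E snd (fun=> erefl)).
have sums A B (s : R * R -> int) :
    \sum_(e \in reverse_chord @^-1` A) (s \o reverse_chord) e +
    \sum_(e \in reverse_chord @^-1` B) (- (s \o reverse_chord) e) =
    \sum_(e \in A) s e + \sum_(e \in B) (- s e).
  by rewrite (fsum_preimage_involutive A s reverse_chordK)
             (fsum_preimage_involutive B (fun e => - s e) reverse_chordK).
exact: sums.
Qed.

(** * Index functions and phase functions *)

Lemma index_functionE D c (A B : set (R * R)) (w : R * R -> int) :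
  index_function D c A B w = index_sum (sgn D) A B w.
Proof.
by congr (_ - _); apply: eq_fsbigr => e _; rewrite /phi vmon_modz.
Qed.

(* Stated on symbols x^p: the indices of -D and of D live in R_m for values of m
   that are only propositionally equal. *)
Lemma xpow_index_function_inverse D c (A B : set (R * R)) (w' w : R * R -> int) :
  A `<=` crossings D -> B `<=` crossings D ->
  (forall e, crossings D (reverse_chord e) -> w' e = w (reverse_chord e)) ->
  xpow (index_function (inverse D) c
          (reverse_chord @^-1` A) (reverse_chord @^-1` B) w') =
  xpow (@index_sum `|degree D (reverse_chord c)|%N _ (sgn D) A B w).
Proof.
move=> AD BD ww.
have -> : index_function (inverse D) c
          (reverse_chord @^-1` A) (reverse_chord @^-1` B) w' =
    index_function (inverse D) c
          (reverse_chord @^-1` A) (reverse_chord @^-1` B) (w \o reverse_chord).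
  by congr (_ - _); apply: eq_fsbigr => e /set_mem;
    [move=> /AD/ww -> | move=> /BD/ww ->].
rewrite index_functionE sgn_inverse degree_inverse abszN.
move: (sgn D) `|_|%N => s m.
by rewrite (index_sum_preimage s A B w reverse_chordK).
Qed.

Lemma finite_crossings D : finite_set (crossings D).
Proof.
apply: sub_finite_set (double_finite D) => -[a b].
by case.
Qed.

Lemma chords_from_to_crossings D (A B : set R) :
  chords_from_to D A B `<=` crossings D.
Proof. by move=> e []. Qed.

Lemma finite_chords_from_to D (A B : set R) : finite_set (chords_from_to D A B).
Proof. exact: sub_finite_set (chords_from_to_crossings D A B) (finite_crossings D). Qed.

(** Left and right chords are exchanged and the degrees negated; by [index_sum_swap] the exponents
    survive and only an overall sign remains. *)
Lemma g_index_inverse D c :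
  xpow (g_index (inverse D) c) = xpow (- g_index D (reverse_chord c)).
Proof.
rewrite /g_index right_chords_inverse left_chords_inverse.
apply: etrans (xpow_index_function_inverse _ _ _ _ _ (fun e => - degree D e) _ _ _) _.
- exact: chords_from_to_crossings.
- exact: chords_from_to_crossings.
- by move=> e _; exact: degree_inverse.
- by rewrite index_sum_swap index_functionE.
Qed.

(** The two chord sets correspond without exchange while degrees are negated, which is the effect of
    [Rbar] on exponents. *)
Lemma h_index_inverse D c : crossings D (reverse_chord c) ->
  xpow (h_index (inverse D) c) = xpow (Rbar (h_index D (reverse_chord c))).
Proof.
move=> Dc; rewrite /h_index (rho_chords_inverse _ _ Dc) (lambda_chords_inverse _ _ Dc).
apply: etrans (xpow_index_function_inverse _ _ _ _ _ (fun e => - degree D e) _ _ _) _.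
- exact: chords_from_to_crossings.
- exact: chords_from_to_crossings.
- by move=> e _; exact: degree_inverse.
- by rewrite index_functionE Rbar_index_sum //; exact: finite_chords_from_to.
Qed.

(** The sides are exchanged but the weights keep their sign, so the swap produces an overall sign
    together with inverted exponents. *)
Lemma gt_index_inverse D c :
  xpow (gt_index (inverse D) c) = xpow (Rbar (- gt_index D (reverse_chord c))).
Proof.
rewrite /gt_index right_chords_inverse left_chords_inverse.
apply: etrans (xpow_index_function_inverse _ _ _ _ _ (intersection_index D) _ _ _) _.
- exact: chords_from_to_crossings.
- exact: chords_from_to_crossings.
- exact: intersection_index_inverse.
- rewrite index_functionE -index_sum_swap Rbar_index_sum.
  + by congr (xpow (index_sum _ _ _ _)); apply/funext => e; rewrite opprK.
  + exact: finite_chords_from_to.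
  + exact: finite_chords_from_to.
Qed.

Lemma ht_index_inverse D c : crossings D (reverse_chord c) ->
  xpow (ht_index (inverse D) c) = xpow (ht_index D (reverse_chord c)).
Proof.
move=> Dc; rewrite /ht_index (rho_chords_inverse _ _ Dc) (lambda_chords_inverse _ _ Dc).
apply: etrans (xpow_index_function_inverse _ _ _ _ _ (intersection_index D) _ _ _) _.
- exact: chords_from_to_crossings.
- exact: chords_from_to_crossings.
- exact: intersection_index_inverse.
- by rewrite index_functionE.
Qed.

(** Treats the four phase functions at once: [G] is the substitution, to be checked on single
    symbols, and the minus sign comes from [u_inverse]. *)
Lemma phase_inverse D (p' p : R * R -> xsymbol)
    (G : {additive {freeg xsymbol} -> {freeg xsymbol}}) :
  (forall c, crossings D (reverse_chord c) ->
     << p' c >> = G << p (reverse_chord c) >>) ->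
  \sum_(c \in crossings (inverse D)) << u (inverse D) c *g p' c >> =
  - G (\sum_(c \in crossings D) << u D c *g p c >>).
Proof.
move=> E; have finD := finite_crossings D.
(* Negation and [G] are composed into one additive map, which passes through the sum in a single
   rewrite. *)
rewrite -[RHS]/((-%R \o G) _) raddf_fsum //= crossings_inverse.
rewrite (reindex_fsum_involutive (crossings D) _ reverse_chordK).
apply: eq_fsbigr => c /set_mem Dc.
(* Coefficients become integer multiples, with which the additive map [G] commutes. *)
have U n (x : xsymbol) : << n *g x >> = << x >> *~ n by rewrite freegU_mulz intz.
have Dc' : crossings D (reverse_chord (reverse_chord c)) by rewrite reverse_chordK.
rewrite (u_inverse _ _ Dc') !reverse_chordK -freegUN.
by rewrite [in LHS](U (u D c)) [in RHS](U (u D c)) (raddfMz G) (E _ Dc') !reverse_chordK.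
Qed.

End Inverse.

Theorem theorem4p2 (R : realType) (D : knotoid_diagram R) :
  (B_phase (inverse D) = - inv_x (B_phase D) /\
   C_phase (inverse D) = - inv_v (C_phase D)) /\
  (Bt_phase (inverse D) = - inv_v (inv_x (Bt_phase D)) /\
   Ct_phase (inverse D) = - Ct_phase D).
Proof.
split; split.
- apply: (phase_inverse D _ _ inv_x) => c _.
  exact: etrans (congr1 (fun x => << x >>) (g_index_inverse D c)) (esym (inv_x_xpow _ _)).
- apply: (phase_inverse D _ _ inv_v) => c Dc.
  exact: etrans (congr1 (fun x => << x >>) (h_index_inverse D c Dc)) (esym (inv_v_xpow _ _)).
- apply: (phase_inverse D _ _ (inv_v \o inv_x)) => c _ /=.
  rewrite inv_x_xpow inv_v_xpow.
  exact: (congr1 (fun x => << x >>) (gt_index_inverse D c)).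
- apply: (phase_inverse D _ _ idfun) => c Dc.
  exact: (congr1 (fun x => << x >>) (ht_index_inverse D c Dc)).
Qed.
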